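(* Let $T^{*}$ be the model completion of the theory $T$ of selector functions with the additional relations $R_0,R_1$ (axioms listed in the context). Then $T^{*}$ is NSOP$_1$.
   Context: The language $L$ consists of unary predicates $F, O_0, O_1, O$, binary relations $E, R_0, R_1$, and a binary function $\mathrm{eval}$ (considered only on $F \times O$). The theory $T$ consists of the following axioms: (1) $F$, $O_0$, $O_1$ partition the universe and $O = O_0 \cup O_1$. (2) $E \subseteq O^2$ is an equivalence relation on $O$. (3) $\mathrm{eval} : F \times O \to O_0$ is a selector function: (a) $(\forall x \in F)(\forall y \in O)[E(y,\mathrm{eval}(x,y))]$; (b) $(\forall x \in F)(\forall y,z \in O)[E(y,z) \to \mathrm{eval}(x,y) = \mathrm{eval}(x,z)]$. (4) (a) $R_0 \subseteq O_0 \times O_1$; (b) $R_1 \subseteq F \times O_1$; (c) $(\forall x \in F)(\forall z \in O_1)[R_0(\mathrm{eval}(x,z),z) \leftrightarrow R_1(x,z)]$. The class of finite models of $T$ is a uniformly locally finite Fraïssé class, and $T$ has a model completion $T^{*}$, which is the theory of the Fraïssé limit of this class; $T^{*}$ eliminates quantifiers and is $\aleph_0$-categorical. A formula $\varphi(x;y)$ has SOP$_1$ (modulo a theory) if there is a tree of tuples $(a_\eta)_{\eta \in 2^{<\omega}}$ such that: (i) for all $\eta \in 2^{\omega}$, $\{\varphi(x;a_{\eta|\alpha}) : \alpha < \omega\}$ is consistent; (ii) for all incomparable $\eta \perp \nu$ in $2^{<\omega}$, if $(\eta \wedge \nu)\frown 0 \unlhd \eta$ and $(\eta \wedge \nu)\frown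 1 = \nu$, then $\{\varphi(x;a_\eta),\varphi(x;a_\nu)\}$ is inconsistent. Here $\unlhd$ is the initial-segment order and $\eta\wedge\nu$ the longest common initial segment. A theory has SOP$_1$ if some formula does, and is NSOP$_1$ otherwise. *)

(* Defs.v *)
From mathcomp Require Import all_boot.
From Stdlib Require Import FunctionalExtensionality.

Set Implicit Arguments.
Unset Strict Implicit.
Unset Printing Implicit Defensive.

Record language := Language {
  fsym : Type;
  farity : fsym -> nat;
  rsym : Type;
  rarity : rsym -> nat }.

(* Free variables range over an arbitrary type [V]; a quantifier binds the
   variable [None] of [option V]. *)
Inductive term (L : language) (V : Type) : Type :=
| Var of V
| App (f : fsym L) of ('I_(farity f) -> term L V).

Inductive formula (L : language) (V : Type) : Type :=
| Bot
| Equal of term L V & term L V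
| Rel (r : rsym L) of ('I_(rarity r) -> term L V)
| And of formula L V & formula L V
| Or of formula L V & formula L V
| Imp of formula L V & formula L V
| All of formula L (option V)
| Ex of formula L (option V).

Arguments Var {L V}.
Arguments App {L V}.
Arguments Bot {L V}.
Arguments Equal {L V}.
Arguments Rel {L V}.
Arguments And {L V}.
Arguments Or {L V}.
Arguments Imp {L V}.
Arguments All {L V}.
Arguments Ex {L V}.

Definition Not {L V} (phi : formula L V) : formula L V := Imp phi Bot.
Definition Iff {L V} (phi psi : formula L V) : formula L V :=
  And (Imp phi psi) (Imp psi phi).

Definition sentence (L : language) : Type := formula L void.
Definition theory (L : language) : Type := sentence L -> Prop.

Record structure (L : language) := Structure {
  dom :> Type;
  dom_inhabited : inhabited dom;
  finterp (f : fsym L) : ('I_(farity f) -> dom) -> dom;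
  rinterp (r : rsym L) : ('I_(rarity r) -> dom) -> Prop }.

Fixpoint teval (L : language) (M : structure L) (V : Type) (v : V -> M)
    (t : term L V) : M :=
  match t with
  | Var x => v x
  | App f ts => finterp (fun i => teval v (ts i))
  end.

Fixpoint sat (L : language) (M : structure L) (V : Type) (v : V -> M)
    (phi : formula L V) : Prop :=
  match phi with
  | Bot => False
  | Equal t u => teval v t = teval v u
  | Rel r ts => rinterp (fun i => teval v (ts i))
  | And psi chi => sat v psi /\ sat v chi
  | Or psi chi => sat v psi \/ sat v chi
  | Imp psi chi => sat v psi -> sat v chi
  | All psi => forall a : M, sat (oapp v a) psi
  | Ex psi => exists a : M, sat (oapp v a) psi
  end.

Definition models (L : language) (M : structure L) (T : theory L) : Prop :=
  forall s : sentence L, T s -> sat (of_void M) s.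

Record embedding (L : language) (M N : structure L) (f : M -> N) : Prop := {
  emb_inj : injective f;
  emb_fun (g : fsym L) (a : 'I_(farity g) -> M) :
    f (finterp a) = finterp (f \o a);
  emb_rel (r : rsym L) (a : 'I_(rarity r) -> M) :
    rinterp a <-> rinterp (f \o a) }.

Definition elementary (L : language) (M N : structure L) (f : M -> N) : Prop :=
  forall (V : Type) (v : V -> M) (phi : formula L V),
    sat v phi <-> sat (f \o v) phi.

(* In [mc_complete], a model of T' together with Diag(M) is the same thing as a
   model of T' with an embedding of M into it, and a sentence with constants
   naming elements of M is a formula with an assignment of its free variables
   in M. *)
Record model_completion (L : language) (T T' : theory L) : Prop := {
  mc_extends (M : structure L) : models M T' -> models M T;
  mc_embeds (M : structure L) : models M T ->
    exists (N : structure L) (f : M -> N), models N T' /\ embedding f;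
  mc_complete (M : structure L) : models M T ->
    forall (N1 N2 : structure L) (f1 : M -> N1) (f2 : M -> N2),
    models N1 T' -> models N2 T' -> embedding f1 -> embedding f2 ->
    forall (V : Type) (v : V -> M) (phi : formula L V),
      sat (f1 \o v) phi <-> sat (f2 \o v) phi }.

Definition split_val (A B X : Type) (f : A -> X) (g : B -> X) (s : A + B) : X :=
  match s with inl i => f i | inr j => g j end.

(* Consistency of {phi(x; a_i) : i in I} with the elementary diagram of M: the
   set is realized in some elementary extension of M. *)
Definition consistent (L : language) (n m : nat) (phi : formula L ('I_n + 'I_m))
    (M : structure L) (I : Type) (a : I -> 'I_m -> M) : Prop :=
  exists (N : structure L) (e : M -> N), elementary e /\
  exists b : 'I_n -> N, forall i : I, sat (split_val b (e \o a i)) phi.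

Fixpoint meet (s t : seq bool) : seq bool :=
  match s, t with
  | x :: s', y :: t' => if x == y then x :: meet s' t' else [::]
  | _, _ => [::]
  end.

Definition incomparable (s t : seq bool) : bool :=
  ~~ prefix s t && ~~ prefix t s.

(* Nodes of 2^{<omega} are boolean sequences, with 0 = false and 1 = true. *)
Definition formula_SOP1 (L : language) (T : theory L) (n m : nat)
    (phi : formula L ('I_n + 'I_m)) : Prop :=
  exists (M : structure L) (a : seq bool -> 'I_m -> M),
  [/\ models M T,
      forall eta : nat -> bool,
        consistent phi (fun k : nat => a (mkseq eta k))
    & forall eta nu : seq bool, incomparable eta nu ->
        prefix (rcons (meet eta nu) false) eta ->
        rcons (meet eta nu) true = nu ->
        ~ consistent phi (fun c : bool => a (if c then nu else eta))].

Definition SOP1 (L : language) (T : theory L) : Prop :=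
  exists (n m : nat) (phi : formula L ('I_n + 'I_m)), formula_SOP1 T phi.

Definition NSOP1 (L : language) (T : theory L) : Prop := ~ SOP1 T.

Inductive sel_fsym : Type := sEval.
Inductive sel_rsym : Type := sF | sO0 | sO1 | sO | sE | sR0 | sR1.

Definition sel_rarity (r : sel_rsym) : nat :=
  match r with
  | sF | sO0 | sO1 | sO => 1
  | sE | sR0 | sR1 => 2
  end.

Definition sel_lang : language :=
  @Language sel_fsym (fun _ => 2) sel_rsym sel_rarity.

Definition arg1 (X : Type) (x : X) : 'I_1 -> X := fun _ => x.
Definition arg2 (X : Type) (x y : X) : 'I_2 -> X :=
  fun i => if i == ord0 then x else y.

Section Atoms.

Variable V : Type.
Notation tm := (term sel_lang V).
Notation fm := (formula sel_lang V).

Definition tEval (t u : tm) : tm := @App sel_lang V sEval (arg2 t u).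
Definition fF (t : tm) : fm := @Rel sel_lang V sF (arg1 t).
Definition fO0 (t : tm) : fm := @Rel sel_lang V sO0 (arg1 t).
Definition fO1 (t : tm) : fm := @Rel sel_lang V sO1 (arg1 t).
Definition fO (t : tm) : fm := @Rel sel_lang V sO (arg1 t).
Definition fE (t u : tm) : fm := @Rel sel_lang V sE (arg2 t u).
Definition fR0 (t u : tm) : fm := @Rel sel_lang V sR0 (arg2 t u).
Definition fR1 (t u : tm) : fm := @Rel sel_lang V sR1 (arg2 t u).

End Atoms.

Definition All1 (phi : forall x : term sel_lang (option void),
    formula sel_lang (option void)) : sentence sel_lang :=
  All (phi (Var None)).
Definition All2 (phi : forall x y : term sel_lang (option (option void)),
    formula sel_lang (option (option void))) : sentence sel_lang :=
  All (All (phi (Var (Some None)) (Var None))).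
Definition All3 (phi :
  forall x y z : term sel_lang (option (option (option void))),
    formula sel_lang (option (option (option void)))) : sentence sel_lang :=
  All (All (All (phi (Var (Some (Some None))) (Var (Some None)) (Var None)))).

(* The function eval is only meaningful on F x O; as function symbols denote
   total functions, [sel_junk] gives it the dummy value eval(x, y) = x
   elsewhere, so that it generates no new elements outside F x O. *)
Inductive sel_theory : theory sel_lang :=
| sel_cover : sel_theory (All1 (fun x => Or (fF x) (Or (fO0 x) (fO1 x))))
| sel_disjF0 : sel_theory (All1 (fun x => Not (And (fF x) (fO0 x))))
| sel_disjF1 : sel_theory (All1 (fun x => Not (And (fF x) (fO1 x))))
| sel_disj01 : sel_theory (All1 (fun x => Not (And (fO0 x) (fO1 x))))
| sel_O : sel_theory (All1 (fun x => Iff (fO x) (Or (fO0 x) (fO1 x))))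
| sel_E_dom : sel_theory (All2 (fun x y => Imp (fE x y) (And (fO x) (fO y))))
| sel_E_refl : sel_theory (All1 (fun x => Imp (fO x) (fE x x)))
| sel_E_sym : sel_theory (All2 (fun x y => Imp (fE x y) (fE y x)))
| sel_E_trans :
    sel_theory (All3 (fun x y z => Imp (And (fE x y) (fE y z)) (fE x z)))
| sel_eval_O0 :
    sel_theory (All2 (fun x y => Imp (And (fF x) (fO y)) (fO0 (tEval x y))))
| sel_eval_E :
    sel_theory (All2 (fun x y => Imp (And (fF x) (fO y)) (fE y (tEval x y))))
| sel_eval_const :
    sel_theory (All3 (fun x y z => Imp (And (fF x) (And (fO y) (fO z)))
      (Imp (fE y z) (Equal (tEval x y) (tEval x z)))))
| sel_R0_dom :
    sel_theory (All2 (fun x y => Imp (fR0 x y) (And (fO0 x) (fO1 y))))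
| sel_R1_dom :
    sel_theory (All2 (fun x y => Imp (fR1 x y) (And (fF x) (fO1 y))))
| sel_R0_R1 :
    sel_theory (All2 (fun x z => Imp (And (fF x) (fO1 z))
      (Iff (fR0 (tEval x z) z) (fR1 x z))))
| sel_junk :
    sel_theory (All2 (fun x y => Imp (Not (And (fF x) (fO y)))
      (Equal (tEval x y) x))).

Section SelModels.

Variable M : structure sel_lang.

Definition evalM (x y : M) : M := @finterp sel_lang M sEval (arg2 x y).
Definition FM (x : M) : Prop := @rinterp sel_lang M sF (arg1 x).
Definition O0M (x : M) : Prop := @rinterp sel_lang M sO0 (arg1 x).
Definition O1M (x : M) : Prop := @rinterp sel_lang M sO1 (arg1 x).
Definition OM (x : M) : Prop := @rinterp sel_lang M sO (arg1 x).
Definition EM (x y : M) : Prop := @rinterp sel_lang M sE (arg2 x y).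
Definition R0M (x y : M) : Prop := @rinterp sel_lang M sR0 (arg2 x y).
Definition R1M (x y : M) : Prop := @rinterp sel_lang M sR1 (arg2 x y).

Record sel_axioms : Prop := {
  sel_coverM x : FM x \/ O0M x \/ O1M x;
  sel_disjF0M x : ~ (FM x /\ O0M x);
  sel_disjF1M x : ~ (FM x /\ O1M x);
  sel_disj01M x : ~ (O0M x /\ O1M x);
  sel_OM x : OM x <-> O0M x \/ O1M x;
  sel_E_domM x y : EM x y -> OM x /\ OM y;
  sel_E_reflM x : OM x -> EM x x;
  sel_E_symM x y : EM x y -> EM y x;
  sel_E_transM x y z : EM x y /\ EM y z -> EM x z;
  sel_eval_O0M x y : FM x /\ OM y -> O0M (evalM x y);
  sel_eval_EM x y : FM x /\ OM y -> EM y (evalM x y);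
  sel_eval_constM x y z :
    FM x /\ OM y /\ OM z -> EM y z -> evalM x y = evalM x z;
  sel_R0_domM x y : R0M x y -> O0M x /\ O1M y;
  sel_R1_domM x y : R1M x y -> FM x /\ O1M y;
  sel_R0_R1M x z : FM x /\ O1M z -> (R0M (evalM x z) z <-> R1M x z);
  sel_junkM x y : ~ (FM x /\ OM y) -> evalM x y = x }.

Lemma teval_arg2 (V : Type) (v : V -> M) (t u : term sel_lang V) :
  (fun i => teval v (arg2 t u i)) = arg2 (teval v t) (teval v u).
Proof. by apply: functional_extensionality => i; rewrite /arg2; case: ifP. Qed.

Lemma teval_arg1 (V : Type) (v : V -> M) (t : term sel_lang V) :
  (fun i => teval v (arg1 t i)) = arg1 (teval v t).
Proof. by []. Qed.

Let tevalE := (teval_arg1, teval_arg2).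

Lemma models_sel_theory : models M sel_theory <-> sel_axioms.
Proof.
split=> [H|[H1 H2 H3 H4 H5 H6 H7 H8 H9 H10 H11 H12 H13 H14 H15 H16] s].
  split.
  - exact: (H _ sel_cover).
  - exact: (H _ sel_disjF0).
  - exact: (H _ sel_disjF1).
  - exact: (H _ sel_disj01).
  - exact: (H _ sel_O).
  - by move=> x y; have := H _ sel_E_dom x y;
    rewrite /= ?tevalE /= ?tevalE.
  - by move=> x; have := H _ sel_E_refl x;
    rewrite /= ?tevalE /= ?tevalE.
  - by move=> x y; have := H _ sel_E_sym x y;
    rewrite /= ?tevalE /= ?tevalE.
  - by move=> x y z; have := H _ sel_E_trans x y z;
    rewrite /= ?tevalE /= ?tevalE.
  - by move=> x y; have := H _ sel_eval_O0 x y;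
    rewrite /= ?tevalE /= ?tevalE.
  - by move=> x y; have := H _ sel_eval_E x y;
    rewrite /= ?tevalE /= ?tevalE.
  - by move=> x y z; have := H _ sel_eval_const x y z;
    rewrite /= ?tevalE /= ?tevalE.
  - by move=> x y; have := H _ sel_R0_dom x y;
    rewrite /= ?tevalE /= ?tevalE.
  - by move=> x y; have := H _ sel_R1_dom x y;
    rewrite /= ?tevalE /= ?tevalE.
  - by move=> x z; have := H _ sel_R0_R1 x z;
    rewrite /= ?tevalE /= ?tevalE.
  - by move=> x y; have := H _ sel_junk x y;
    rewrite /= ?tevalE /= ?tevalE.
case.
- exact: H1.
- exact: H2.
- exact: H3.
- exact: H4.
- exact: H5.
- by move=> x y; rewrite /= ?tevalE /= ?tevalE; exact: H6.
- by move=> x; rewrite /= ?tevalE /= ?tevalE; exact: H7.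
- by move=> x y; rewrite /= ?tevalE /= ?tevalE; exact: H8.
- by move=> x y z; rewrite /= ?tevalE /= ?tevalE; exact: H9.
- by move=> x y; rewrite /= ?tevalE /= ?tevalE; exact: H10.
- by move=> x y; rewrite /= ?tevalE /= ?tevalE; exact: H11.
- by move=> x y z; rewrite /= ?tevalE /= ?tevalE; exact: H12.
- by move=> x y; rewrite /= ?tevalE /= ?tevalE; exact: H13.
- by move=> x y; rewrite /= ?tevalE /= ?tevalE; exact: H14.
- by move=> x z; rewrite /= ?tevalE /= ?tevalE; exact: H15.
- by move=> x y; rewrite /= ?tevalE /= ?tevalE; exact: H16.
Qed.

End SelModels.

(* Main.v *)
(** Climbing an SOP1 tree and using the pigeonhole principle on the finitely
    many diagrams of finite tuples gives d_k = a_(eta_k) along a branch and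
    e_k = a_(nu_k) off it, such that (d_i, d_j) and (d_i, e_j) have the same
    diagram for i < j, while phi(x; e_i) and phi(x; d_j) are inconsistent.
    Let b realize phi(x; d_k) for all k in a model N of T*.  After a Ramsey
    argument, an element of cl(b) /\ cl(d_k), or of cl(e_i) /\ cl(d_j) with
    i < j, does not depend on the indices, and the same holds for E-classes
    met by both sides.  This is the independence required to glue three copies
    of N into a model P of T: "Left" to "Base" along cl(d_i) ~ cl(e_i), "Right"
    to "Base" along cl(d_j), and "Left" to "Right" along a set of such constant
    elements that contains b.  In a model Q of T* above P, the three copies of
    N are elementary because T* is model complete, so the common image of b
    realizes phi(x; e_i) and phi(x; d_j), a contradiction. *)
From mathcomp Require Import all_boot.
From mathcomp Require Import boolp classical_sets filter.
Require Import Defs.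

Set Implicit Arguments.
Unset Strict Implicit.
Unset Printing Implicit Defensive.

(** * Ultrafilter pigeonhole and a Ramsey pattern on the natural numbers *)

Section Pigeonhole.
Variables (U : set_system nat) (UU : UltraFilter U).

(** If every colour class were outside [U], the complements would all lie in [U], and so would their
    finite intersection, which is empty. *)
Lemma ultra_color (C : finType) (f : nat -> C) :
  exists c, U (fun i => f i = c).
Proof.
apply: contrapT => /forallNP Uf.
have : U (fun i => forall c, f i <> c).
  apply: filter_forall => c.
  by have [/Uf|] := in_ultra_setVsetC (fun i => f i = c) UU.
by move=> /filter_ex[i]; apply.
Qed.

Hypothesis Uoo : forall n, U (fun i => n < i).

Lemma ultra_ex_gt (A : nat -> Prop) n : U A -> exists2 i, n < i & A i.
Proof. by move=> UA; have [i []] := filter_ex (filterI (Uoo n) UA); exists i. Qed.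

End Pigeonhole.

Lemma free_ultrafilter :
  exists2 U : set_system nat, UltraFilter U & forall n, U (fun i => n < i).
Proof.
have [U [UU sU]] := ultraFilterLemma eventually_filter.
by exists U => // n; apply: sU; exists n.+1.
Qed.

Lemma pigeonhole (C : finType) (f : nat -> C) : exists i j, i < j /\ f i = f j.
Proof.
have [U UU Uoo] := free_ultrafilter.
have [c Uc] := ultra_color UU f.
have [i _ fi] := ultra_ex_gt UU Uoo 0 Uc.
have [j ij fj] := ultra_ex_gt UU Uoo i Uc.
by exists i, j; rewrite fi fj.
Qed.

(* Along a free ultrafilter, g i j has a limit h i in j, and h has a limit. *)
Lemma ramsey_pattern (C1 C2 : finType) (f : nat -> C1) (g : nat -> nat -> C2) :
  exists i0 i1 i2 i3,
  [/\ i0 < i1 /\ i1 < i2 /\ i2 < i3, f i1 = f i2, f i2 = f i3,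
      g i0 i1 = g i0 i2 /\ g i0 i2 = g i0 i3 & g i0 i3 = g i2 i3].
Proof.
have [U UU Uoo] := free_ultrafilter.
have /choice[h hP] i := ultra_color UU (g i).
have [c Uc] := ultra_color UU f.
have [d Ud] := ultra_color UU h.
have [i0 _ hi0] := ultra_ex_gt UU Uoo 0 Ud.
have [i1 i01 [fi1 gi1]] := ultra_ex_gt UU Uoo i0 (filterI Uc (hP i0)).
have [i2 i12 [[fi2 gi2] hi2]] :=
  ultra_ex_gt UU Uoo i1 (filterI (filterI Uc (hP i0)) Ud).
have [i3 i23 [[fi3 g03] g23]] :=
  ultra_ex_gt UU Uoo i2 (filterI (filterI Uc (hP i0)) (hP i2)).
by exists i0, i1, i2, i3; rewrite fi1 fi2 fi3 gi1 gi2 g03 g23 hi0 hi2.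
Qed.

(** * Gluing three copies of a set *)

Inductive corner := Base | Left | Right.

(* A model P is obtained from three copies of a set X: "Left" is glued to "Base"
   by [s] on [B1], "Right" to "Base" on [B2], "Left" to "Right" on [D].  [glue]
   chooses representatives, and [link] describes the induced identification. *)
Section Glue.
Variables (X : Type) (B1 B2 D : X -> Prop) (s : X -> X).

Definition glue (k : corner) (x : X) : corner * X :=
  match k with
  | Base => (Base, x)
  | Left => if `[< B1 x >] then (Base, s x)
            else if `[< D x >] then (Right, x) else (Left, x)
  | Right => if `[< B2 x >] then (Base, x) else (Right, x)
  end.

Definition link (k l : corner) (x y : X) : Prop :=
  match k, l with
  | Base, Left => B1 y /\ x = s y
  | Left, Base => B1 x /\ s x = y
  | Base, Right | Right, Base => B2 x /\ x = y
  | Left, Right | Right, Left => D x /\ x = y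
  | _, _ => x = y
  end.

(** Transitivity of [link]: [s] is injective on [B1], and each other clause says that two
    identifications around the triangle of corners imply the third. *)
Record glueable : Prop := {
  glue_inj x y : B1 x -> B1 y -> s x = s y -> x = y;
  glue_D1 x : D x -> B1 x -> s x = x /\ B2 x;
  glue_D2 x : D x -> B2 x -> B1 x /\ s x = x;
  glue_12 x : B1 x -> B2 (s x) -> s x = x /\ D x }.

Lemma glueE k l x y : glueable -> (glue k x = glue l y <-> link k l x y).
Proof.
move=> [si D1 D2 D12].
have eqP (a b : corner) (u v : X) : (a, u) = (b, v) <-> a = b /\ u = v.
  by split=> [[]|[-> ->]].
case: k; case: l => /=; do ?[case: asboolP => ?]; rewrite eqP;
  split=> H; decompose [and] H; subst; try discriminate; try by auto.
all: try by case: (D1 y).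
all: try by case: (D2 y).
all: try by case: (D12 x).
all: try by case: (D12 y) => // ->.
all: try by case: (D1 x).
all: by case: (D2 x).
Qed.

End Glue.

(** * Structures for the language of selector functions and their embeddings *)

Section Building.
Variables (X : Type) (X0 : inhabited X) (ev : X -> X -> X).
Variables (F O0 O1 : X -> Prop) (E R0 : X -> X -> Prop).

(* By (4c), R1 is determined by R0 and eval. *)
Definition sel_structure : structure sel_lang :=
  @Structure sel_lang X X0
    (fun _ a => ev (a ord0) (a ord_max))
    (fun r => match r return ('I_(sel_rarity r) -> X) -> Prop with
      | sF => fun a => F (a ord0)
      | sO0 => fun a => O0 (a ord0)
      | sO1 => fun a => O1 (a ord0)
      | sO => fun a => O0 (a ord0) \/ O1 (a ord0)
      | sE => fun a => E (a ord0) (a ord_max)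
      | sR0 => fun a => R0 (a ord0) (a ord_max)
      | sR1 => fun a => [/\ F (a ord0), O1 (a ord_max)
                          & R0 (ev (a ord0) (a ord_max)) (a ord_max)]
      end).

End Building.

Lemma arg1E (X : Type) (a : 'I_1 -> X) : a = arg1 (a ord0).
Proof. by apply/funext => i; rewrite (ord1 i). Qed.

Lemma arg2E (X : Type) (a : 'I_2 -> X) : a = arg2 (a ord0) (a ord_max).
Proof.
apply/funext => -[[|[|//]] lt_i]; rewrite /arg2 /=; congr a; exact: val_inj.
Qed.

Lemma arg1_comp (X Y : Type) (f : X -> Y) x : f \o arg1 x = arg1 (f x).
Proof. by []. Qed.

Lemma arg2_comp (X Y : Type) (f : X -> Y) x y :
  f \o arg2 x y = arg2 (f x) (f y).
Proof. by apply/funext => i; rewrite /arg2 /=; case: ifP. Qed.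

Section SelEmbedding.
Variables (M N : structure sel_lang) (f : M -> N).

(** Preservation of [O] and [R1] follows in models of [sel_axioms], where both are quantifier-free
    definable from the other symbols. *)
Record sel_embedding : Prop := {
  semb_inj : injective f;
  semb_eval x y : f (evalM x y) = evalM (f x) (f y);
  semb_F x : FM (f x) <-> FM x;
  semb_O0 x : O0M (f x) <-> O0M x;
  semb_O1 x : O1M (f x) <-> O1M x;
  semb_E x y : EM (f x) (f y) <-> EM x y;
  semb_R0 x y : R0M (f x) (f y) <-> R0M x y }.

Lemma sel_R1E (P : structure sel_lang) : sel_axioms P -> forall x y : P,
  R1M x y <-> [/\ FM x, O1M y & R0M (evalM x y) y].
Proof.
move=> HP x y; split=> [Rxy|[Fx Oy Rxy]]; last exact/(sel_R0_R1M HP (conj Fx Oy)).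
have [Fx Oy] := sel_R1_domM HP Rxy.
by split=> //; apply/(sel_R0_R1M HP (conj Fx Oy)).
Qed.

Lemma sel_embeddingP : sel_axioms M -> sel_axioms N ->
  sel_embedding -> embedding f.
Proof.
move=> HM HN [fi fev fF fO0 fO1 fE fR0]; split=> // [[] a|].
  by rewrite (arg2E a) arg2_comp; apply: fev.
case=> a; first [rewrite (arg1E a) arg1_comp | rewrite (arg2E a) arg2_comp].
- exact: iff_sym (fF _).
- exact: iff_sym (fO0 _).
- exact: iff_sym (fO1 _).
- by rewrite -/(OM _) -/(OM _) !sel_OM // fO0 fO1.
- exact: iff_sym (fE _ _).
- exact: iff_sym (fR0 _ _).
- rewrite -/(R1M _ _) -/(R1M (f _) _) !sel_R1E // -fev.
  by rewrite (propext (fF _)) (propext (fO1 _)) (propext (fR0 _ _)).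
Qed.

Lemma elementary_sel_embedding : elementary f -> sel_embedding.
Proof.
move=> fe.
have atom1 (phi : formula sel_lang unit) x :
    sat (fun=> x) phi <-> sat (fun=> f x) phi by apply: fe.
have atom2 (phi : formula sel_lang bool) x y :
    sat (fun b => if b then x else y) phi <->
    sat (fun b => if b then f x else f y) phi.
  rewrite (fe _ _ phi).
  suff -> : f \o (fun b => if b then x else y) = fun b => if b then f x else f y.
    by [].
  by apply/funext => -[].
split.
- by move=> x y; have /= [_] := atom2 (Equal (Var true) (Var false)) x y.
(* The default value of [nth] makes variable 2 name [evalM x y], so that the equation holds in [M]
   by reflexivity. *)
- move=> x y; pose v (i : nat) := nth (evalM x y) [:: x; y] i.
  have /= := fe _ v (Equal (tEval (Var 0) (Var 1)) (Var 2)).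
  by rewrite !teval_arg2 /= => -[<-].
- by move=> x; have [] := atom1 (fF (Var tt)) x.
- by move=> x; have [] := atom1 (fO0 (Var tt)) x.
- by move=> x; have [] := atom1 (fO1 (Var tt)) x.
- move=> x y; have /= := atom2 (fE (Var true) (Var false)) x y.
  by rewrite !teval_arg2 => -[].
- move=> x y; have /= := atom2 (fR0 (Var true) (Var false)) x y.
  by rewrite !teval_arg2 => -[].
Qed.

End SelEmbedding.

(** * Free amalgamation of three copies of a model *)

Section Amalgam.
Variables (M : structure sel_lang) (HM : sel_axioms M).
Variables (B1 B2 D D' : M -> Prop) (s : M -> M).

(* Elements are glued along [D], but E-classes along the possibly larger set of
   classes of elements of [D']. *)
Record amalgamable : Prop := {
  B1_eval x y : B1 x -> B1 y -> B1 (evalM x y);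
  B2_eval x y : B2 x -> B2 y -> B2 (evalM x y);
  D_eval x y : D x -> D' y -> D (evalM x y);
  D_D' x : D x -> OM x -> D' x;
  s_F x : B1 x -> (FM (s x) <-> FM x);
  s_O0 x : B1 x -> (O0M (s x) <-> O0M x);
  s_O1 x : B1 x -> (O1M (s x) <-> O1M x);
  s_E x y : B1 x -> B1 y -> (EM (s x) (s y) <-> EM x y);
  s_R0 x y : B1 x -> B1 y -> (R0M (s x) (s y) <-> R0M x y);
  s_eval x y : B1 x -> B1 y -> s (evalM x y) = evalM (s x) (s y);
  elt_glueable : glueable B1 B2 D s;
  cls_D1 x y : D' x -> B1 y -> EM x y ->
    EM y (s y) /\ exists2 z, B2 z & EM y z;
  cls_D2 x y : D' x -> B2 y -> EM x y ->
    exists z, [/\ B1 z, EM y z & EM z (s z)];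
  cls_12 x y : B1 x -> B2 y -> EM (s x) y -> EM x (s x) /\ D' x }.

Hypothesis A : amalgamable.

Definition classes_of (B : M -> Prop) (C : M -> Prop) : Prop :=
  exists x, [/\ B x, OM x & C = EM x].
(** The map induced by [s] on the classes that meet [B1]; elsewhere its value is the empty
    predicate. Classes are encoded as predicates [EM x], so that [glue] and [link] apply to them as
    well. *)
Definition class_map (C : M -> Prop) (y : M) : Prop :=
  exists x, [/\ B1 x, OM x, C = EM x & EM (s x) y].

Let glueK := glue (classes_of B1) (classes_of B2) (classes_of D') class_map.
Let linkK := link (classes_of B1) (classes_of B2) (classes_of D') class_map.
Let lnk := link B1 B2 D s.

Lemma EM_class (x y : M) : OM y -> EM x = EM y <-> EM x y.
Proof.
move=> Oy; split=> [->|Exy]; first exact: sel_E_reflM.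
apply/funext => z; apply/propext; split=> [Exz|Eyz].
  by apply: (sel_E_transM HM (y := x)); split=> //; apply: sel_E_symM.
by apply: (sel_E_transM HM (y := y)).
Qed.

Lemma s_O x : B1 x -> (OM (s x) <-> OM x).
Proof. by move=> Bx; rewrite !sel_OM // (s_O0 A Bx) (s_O1 A Bx). Qed.

Lemma class_mapE x : B1 x -> OM x -> class_map (EM x) = EM (s x).
Proof.
move=> Bx Ox; apply/funext => z; apply/propext; split=> [|Exz]; last by exists x.
case=> y [By Oy /EM_class Exy Eyz]; apply: (sel_E_transM HM (y := s y)).
by split=> //; apply/(s_E A) => //; apply: Exy.
Qed.

(** The clauses [cls_D1], [cls_D2] and [cls_12] are the triangle conditions read on representatives;
    injectivity comes from [s_E]. *)
Lemma classes_glueable :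
  glueable (classes_of B1) (classes_of B2) (classes_of D') class_map.
Proof.
split.
- move=> _ _ [x [Bx Ox ->]] [y [By Oy ->]]; rewrite !class_mapE //.
  have Osy : OM (s y) by apply/s_O.
  by move=> /(EM_class _ Osy) /(s_E A Bx By) /(EM_class _ Oy).
- move=> _ [x [Dx Ox ->]] [y [By Oy /(EM_class _ Oy) Exy]].
  have [Eys [z Bz Eyz]] := cls_D1 A Dx By Exy.
  have Osy : OM (s y) by apply/s_O.
  have Oz : OM z by have [] := sel_E_domM HM Eyz.
  have -> : EM x = EM y by apply/EM_class.
  rewrite class_mapE //; split; first by apply/esym/EM_class.
  by exists z; split=> //; apply/EM_class.
- move=> _ [x [Dx Ox ->]] [y [By Oy /(EM_class _ Oy) Exy]].
  have [z [Bz Eyz Ezs]] := cls_D2 A Dx By Exy.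
  have Oz : OM z by have [] := sel_E_domM HM Eyz.
  have Osz : OM (s z) by apply/s_O.
  have -> : EM x = EM y by apply/EM_class.
  have -> : EM y = EM z by apply/EM_class.
  rewrite class_mapE //; split; last by apply/esym/EM_class.
  by exists z.
- move=> _ [x [Bx Ox ->]] [y [By Oy]].
  rewrite class_mapE // => /(EM_class _ Oy) Exy.
  have [Exs Dx] := cls_12 A Bx By Exy.
  have Osx : OM (s x) by apply/s_O.
  by split; [apply/esym/EM_class | exists x].
Qed.

Lemma link_class k l x y : lnk k l x y -> OM x -> linkK k l (EM x) (EM y).
Proof.
have := class_mapE; have := D_D' A; have := s_O.
rewrite /lnk /linkK /classes_of; case: k; case: l => //= sO dD sE.
all: try by move=> ->.
all: try (by case=> ? <- ?; split=> //; exists x).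
- by case=> By -> /(sO _ By) Oy; rewrite sE //; split=> //; exists y.
- by case=> Bx <- Ox; rewrite sE //; split=> //; exists x.
all: by case=> Dx <- Ox; split=> //; exists x; split=> //; apply: dD.
Qed.

Lemma eval_class (f x y : M) : FM f -> OM x -> OM y -> EM x = EM y ->
  evalM f x = evalM f y.
Proof. by move=> Ff Ox Oy /(EM_class _ Oy) /(sel_eval_constM HM); apply. Qed.

(** By (3b), eval depends only on the class of its second argument, so [x] and [x'] can be replaced
    by a representative [z] in the glued set, or by its image under [s]. The clauses [B1_eval],
    [B2_eval] and [D_eval] then keep the values glued. *)
Lemma link_eval k l f f' x x' : lnk k l f f' -> FM f -> OM x -> OM x' ->
  linkK k l (EM x) (EM x') -> lnk k l (evalM f x) (evalM f' x').
Proof.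
move=> + Ff Ox Ox'; rewrite /lnk /linkK.
case: k; case: l => //=.
- by move=> <- E; rewrite (@eval_class _ x x').
- case=> Bf Ef [[z [Bz Oz Ez]]].
  rewrite Ez class_mapE // => Exz.
  have Ff' : FM f' by apply/(s_F A); rewrite -?Ef.
  have Osz : OM (s z) by apply/s_O.
  rewrite (@eval_class _ x' z) // (@eval_class _ x (s z)) // Ef -(s_eval A) //.
  by split=> //; apply: (B1_eval A).
- case=> Bf <- [[z [Bz Oz Ez]] Exx].
  rewrite -(@eval_class _ x x') // (@eval_class _ x z) //.
  by split=> //; apply: (B2_eval A).
- case=> Bf <- [[z [Bz Oz Ez]]].
  rewrite Ez class_mapE // => Exz; have Fsf : FM (s f) by apply/(s_F A).
  have Osz : OM (s z) by apply/s_O.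
  rewrite (@eval_class _ x z) // -(@eval_class _ (s z) x') // -(s_eval A) //.
  by split=> //; apply: (B1_eval A).
- by move=> <- E; rewrite (@eval_class _ x x').
- case=> Df <- [[z [Dz Oz Ez]] Exx].
  rewrite -(@eval_class _ x x') // (@eval_class _ x z) //.
  by split=> //; apply: (D_eval A).
- case=> Bf <- [[z [Bz Oz Ez]] Exx].
  rewrite -(@eval_class _ x x') // (@eval_class _ x z) //.
  by split=> //; apply: (B2_eval A).
- case=> Df <- [[z [Dz Oz Ez]] Exx].
  rewrite -(@eval_class _ x x') // (@eval_class _ x z) //.
  by split=> //; apply: (D_eval A).
- by move=> <- E; rewrite (@eval_class _ x x').
Qed.

Lemma link_sort (S : M -> Prop) k l x y :
  (forall z, B1 z -> (S (s z) <-> S z)) -> lnk k l x y -> (S x <-> S y).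
Proof.
move=> sS; rewrite /lnk; case: k; case: l => //=;
  first [by move=> -> | by case=> ? -> | by case=> /sS ? ->
        | by case=> /sS H <-; rewrite -H].
Qed.

Lemma link_R0 k l x y x' y' : lnk k l x y -> lnk k l x' y' ->
  (R0M x x' <-> R0M y y').
Proof.
rewrite /lnk; case: k; case: l => //=;
  first [by move=> -> -> | by case=> ? -> [? ->]
        | by case=> ? -> [? ->]; apply: (s_R0 A)
        | by case=> ? <- [? <-]; apply: iff_sym; apply: (s_R0 A)].
Qed.

(** [R0] holds only inside a copy, and eval is chosen as a function of an element and a glued class,
    which gives (3b). Since [R1] is then defined through (4c), a value of eval not forced by some
    copy may be any point of [O0] in the class. *)
Lemma amalgamation : exists (P : structure sel_lang) (g : corner -> M -> P),
  [/\ sel_axioms P, forall k, sel_embedding (g k)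
    & forall k l x y, link B1 B2 D s k l x y -> g k x = g l y].
Proof.
pose P := {p | exists k x, glue B1 B2 D s k x = p}.
pose g k x : P := exist _ (glue B1 B2 D s k x)
  (ex_intro _ k (ex_intro _ x erefl)).
have gE k l x y : g k x = g l y <-> lnk k l x y.
  rewrite /lnk -(glueE k l x y (elt_glueable A)).
  by split=> [/(congr1 sval)|E]; [|apply: eq_exist].
have /choice[rep repE] (p : P) : exists kx, g kx.1 kx.2 = p.
  by case: p => p [k [x E]]; exists (k, x); apply: eq_exist.
have link_rep k x : lnk (rep (g k x)).1 k (rep (g k x)).2 x by rewrite -gE.
pose FP p := FM (rep p).2; pose O0P p := O0M (rep p).2.
pose O1P p := O1M (rep p).2; pose OP p := OM (rep p).2.
pose cls p := glueK (rep p).1 (EM (rep p).2).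
have Fg k x : FP (g k x) <-> FM x by apply: link_sort (s_F A) (link_rep k x).
have O0g k x : O0P (g k x) <-> O0M x by apply: link_sort (s_O0 A) (link_rep k x).
have O1g k x : O1P (g k x) <-> O1M x by apply: link_sort (s_O1 A) (link_rep k x).
have Og k x : OP (g k x) <-> OM x by apply: link_sort s_O (link_rep k x).
have glueKE k l C C' : glueK k C = glueK l C' <-> linkK k l C C'.
  exact: glueE classes_glueable.
have clsg k x : OM x -> cls (g k x) = glueK k (EM x).
  by move=> Ox; apply/glueKE/(link_class (link_rep k x))/(Og k x).
(* The last clause makes every [g k] commute with eval. *)
pose good p c r := [/\ O0P r, cls r = c & forall k f y, p = g k f -> OM y ->
  c = glueK k (EM y) -> r = g k (evalM f y)].
have /choice[ev evP] (pc : P * (corner * (M -> Prop))) : exists r,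
    FP pc.1 -> (exists2 q, OP q & pc.2 = cls q) -> good pc.1 pc.2 r.
  case: pc => p c /=; have [Fp|] := pselect (FP p); last by exists p.
  have [[q Oq clsq]|] := pselect (exists2 q, OP q & c = cls q); last by exists p.
  have eval_good k f y : FM f -> OM y -> O0P (g k (evalM f y)) /\
      cls (g k (evalM f y)) = glueK k (EM y).
    move=> Ff Oy; have O0e := sel_eval_O0M HM (conj Ff Oy).
    have Oe : OM (evalM f y) by apply/(sel_OM HM); left.
    split; first exact/O0g.
    by rewrite clsg //; congr glueK; apply/esym/EM_class/(sel_eval_EM HM).
  (* If some copy contains [p] and meets [c], the value is computed there; by [link_eval] all such
     copies agree. *)
  have [[k [f [y [pE Oy cE]]]]|no] := pselect (exists k f y,
      [/\ p = g k f, OM y & c = glueK k (EM y)]).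
    exists (g k (evalM f y)) => _ _.
    have Ff : FM f by apply/(Fg k); rewrite -pE.
    have [? eE] := eval_good k _ _ Ff Oy; split=> //; first by rewrite eE.
    move=> l f' y' pE' Oy' cE'; apply/gE/link_eval => //.
      by rewrite -gE -pE.
    by rewrite -glueKE -cE.
  (* No copy contains [p] and meets [c]: the underlying element of [p] is reread in the corner of
     [q], merely to obtain a point of [O0] in the class [c]. *)
  exists (g (rep q).1 (evalM (rep p).2 (rep q).2)) => _ _.
  have [? eE] := eval_good (rep q).1 _ _ Fp Oq; split=> //; first by rewrite eE.
  by move=> k f y pE Oy cE; case: no; exists k, f, y.
pose evp p q := if `[< FP p /\ OP q >] then ev (p, cls q) else p.
pose E p q := [/\ OP p, OP q & cls p = cls q].
pose R0 p q := exists k x y, [/\ p = g k x, q = g k y & R0M x y].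
have P0 : inhabited P by case: (dom_inhabited M) => x; exact: inhabits (g Base x).
pose Q := sel_structure P0 evp FP O0P O1P E R0.
have OPE p : OP p <-> O0P p \/ O1P p by apply: sel_OM.
have evpP p q : FP p /\ OP q -> good p (cls q) (evp p q).
  move=> FO; rewrite /evp asboolT //; case: FO => Fp Oq.
  by apply: (evP (p, cls q)) => //; exists q.
have R0g k x y : R0 (g k x) (g k y) <-> R0M x y.
  split=> [[l [x' [y' [/gE lx /gE ly]]]]|R]; last by exists k, x, y.
  by rewrite (link_R0 lx ly).
exists Q, g; split=> [|k|k l x y /gE//].
  split.
  - by move=> p; apply: (sel_coverM HM (rep p).2).
  - by move=> p H; apply: (sel_disjF0M HM H).
  - by move=> p H; apply: (sel_disjF1M HM H).
  - by move=> p H; apply: (sel_disj01M HM H).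
  - by move=> p.
  - by move=> p q [/OPE Op /OPE Oq _].
  - by move=> p /OPE Op.
  - by move=> p q [].
  - by move=> p q r [[? ? pq] [? ? qr]]; split=> //; rewrite pq.
  - by move=> p q [Fp /OPE Oq]; have [] := evpP p q (conj Fp Oq).
  - move=> p q [Fp /OPE Oq]; have [O0e ce _] := evpP p q (conj Fp Oq).
    by split=> //; apply/OPE; left.
  - move=> p q r [Fp [/OPE Oq /OPE Or]] [_ _ qr].
    have {}qr : cls q = cls r by [].
    by rewrite /evalM /= /evp !asboolT // qr.
  - move=> p q Rpq; have {Rpq} : R0 p q by [].
    case=> k [x [y [-> -> /(sel_R0_domM HM)[Ox Oy]]]].
    by split; [apply/(O0g k) | apply/(O1g k)].
  - by move=> p q [].
  - by move=> p q [Fp Oq]; split=> [|[]].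
  - move=> p q nFO; rewrite /evalM /= /evp asboolF // => -[Fp /OPE Oq].
    exact: nFO.
split.
- by move=> x y /gE; case: (k).
- move=> x y; have [FO|nFO] := pselect (FM x /\ OM y).
    have gFO : FP (g k x) /\ OP (g k y) by case: FO => /Fg ? /Og ?.
    have [_ _ H] := evpP _ _ gFO.
    by case: FO => Fx Oy; rewrite -(H k x y) // clsg.
  rewrite (sel_junkM HM nFO) /evalM /= /evp asboolF //.
  by case=> /Fg ? /Og ?; apply: nFO.
- by move=> x; apply: Fg.
- by move=> x; apply: O0g.
- by move=> x; apply: O1g.
- move=> x y; split=> [[/Og Ox /Og Oy]|Exy].
    by rewrite !clsg // => /glueKE; case: (k) => /(EM_class _ Oy).
  have [Ox Oy] := sel_E_domM HM Exy.
  by split; rewrite ?clsg //; [apply/Og | apply/Og | congr glueK; apply/EM_class].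
- by move=> x y; apply: R0g.
Qed.

End Amalgam.

(** * Diagrams of finite tuples *)

Section Diagrams.
Variables (M : structure sel_lang) (I : finType).
Implicit Types (u v : I -> M).

(* These are all the elements of the substructure generated by u, by
   span_eval. *)
Definition span u (p : I + I * I) : M :=
  match p with inl i => u i | inr (i, j) => evalM (u i) (u j) end.

Record same_diagram u v : Prop := {
  same_eq p q : span u p = span u q <-> span v p = span v q;
  same_F p : FM (span u p) <-> FM (span v p);
  same_O0 p : O0M (span u p) <-> O0M (span v p);
  same_O1 p : O1M (span u p) <-> O1M (span v p);
  same_E p q : EM (span u p) (span u q) <-> EM (span v p) (span v q);
  same_R0 p q : R0M (span u p) (span u q) <-> R0M (span v p) (span v q);
  same_eval p q r : evalM (span u p) (span u q) = span u r <->
    evalM (span v p) (span v q) = span v r }.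

(** The data of [same_diagram] as an element of a finite type, so that it can serve as a colour. *)
Definition diagram u := [ffun t : (I + I * I) * (I + I * I) * (I + I * I) =>
  let x := span u t.1.1 in let y := span u t.1.2 in let z := span u t.2 in
  (`[< x = y >], `[< FM x >], `[< O0M x >], `[< O1M x >], `[< EM x y >],
   `[< R0M x y >], `[< evalM x y = z >])].

Lemma diagramP u v : diagram u = diagram v -> same_diagram u v.
Proof.
move=> uv; have E p q r := congr1 (fun f : {ffun _} => f (p, q, r)) uv.
split=> [p q|p|p|p|p q|p q|p q r];
  [have := E p q p | have := E p p p | have := E p p p | have := E p p p
  | have := E p q p | have := E p q p | have := E p q r];
  by rewrite !ffunE /= => -[*]; apply: asbool_eq_equiv.
Qed.

(** Nested terms collapse: a proper value of eval lies in [O0], so as a first argument it is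
    returned unchanged, and as a second argument it can be replaced by the element whose class it
    selects. *)
Lemma span_eval u : sel_axioms M ->
  forall p q, exists r, evalM (span u p) (span u q) = span u r.
Proof.
move=> HM.
have OE (x y : M) : FM x -> OM y -> OM (evalM x y).
  by move=> Fx Oy; apply/(sel_OM HM); left; apply: (sel_eval_O0M HM).
have OF (x y z : M) : FM x -> OM y -> evalM (evalM x y) z = evalM x y.
  move=> Fx Oy; apply: (sel_junkM HM) => -[Fe _].
  by apply: (sel_disjF0M HM (conj Fe _)); apply: (sel_eval_O0M HM).
have right i q : exists r, evalM (u i) (span u q) = span u r.
  case: q => [j|[j k]] /=; first by exists (inr (i, j)).
  have [[Fj Ok]|/(sel_junkM HM)->] := pselect (FM (u j) /\ OM (u k)); last first.
    by exists (inr (i, j)).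
  have [Fi|nFi] := pselect (FM (u i)).
    exists (inr (i, k)); apply/esym/(sel_eval_constM HM) => //.
      by split=> //; split=> //; apply: OE.
    exact: (sel_eval_EM HM).
  by exists (inl i); apply: (sel_junkM HM) => -[].
move=> p q; case: p => [i|[i j]]; first exact: right.
have [[Fi Oj]|/(sel_junkM HM) /= ->] := pselect (FM (u i) /\ OM (u j)).
  by exists (inr (i, j)); apply: OF.
exact: right.
Qed.

End Diagrams.

Definition span_map (I J : Type) (h : I -> J) (p : I + I * I) : J + J * J :=
  match p with inl i => inl (h i) | inr (i, j) => inr (h i, h j) end.

Lemma span_comp (M : structure sel_lang) (I J : finType) (h : I -> J)
  (u : J -> M) p : span (u \o h) p = span u (span_map h p).
Proof. by case: p => [|[]]. Qed.

Lemma same_diagram_comp (M : structure sel_lang) (I J : finType) (h : I -> J)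
  (u v : J -> M) : same_diagram u v -> same_diagram (u \o h) (v \o h).
Proof. by case=> *; split=> *; rewrite !(@span_comp _ _ _ h). Qed.

Lemma diagram_emb (M N : structure sel_lang) (f : M -> N) (I : finType)
  (u : I -> M) : sel_embedding f -> diagram (f \o u) = diagram u.
Proof.
move=> [fi fev fF fO0 fO1 fE fR0].
have spanf p : span (f \o u) p = f (span u p)
  by case: p => [|[i j]] //=; rewrite fev.
apply/ffunP => t; rewrite !ffunE /= !spanf -fev.
have eqf x y : (f x = f y) <-> (x = y) by split=> [/fi|->].
by congr (_, _, _, _, _, _, _); apply: asbool_equiv_eq.
Qed.

(** * Independence from indiscernibility, and the triangle amalgam *)

Section Triangle.
Variables (M : structure sel_lang) (HM : sel_axioms M) (I J : finType).
Variables (b : J -> M) (d1 d2 d3 e0 e2 : I -> M).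
Hypotheses (b12 : same_diagram (split_val b d1) (split_val b d2)).
Hypotheses (b23 : same_diagram (split_val b d2) (split_val b d3)).
Hypotheses (d12 : same_diagram (split_val d1 d2) (split_val d1 e2)).
Hypotheses (e01 : same_diagram (split_val e0 d1) (split_val e0 d2)).
Hypotheses (e02 : same_diagram (split_val e0 d2) (split_val e0 d3)).
Hypotheses (e03 : same_diagram (split_val e0 d3) (split_val e2 d3)).

(* For R = E this may hold without any element of the class being constant. *)
Definition constant_up_to (R : M -> M -> Prop) (x : M) : Prop :=
  exists r, [/\ R x (span (split_val b d1) r), R x (span (split_val b d2) r)
              & R x (span (split_val b d3) r)].

Let fst_ (K L : finType) (u : K -> M) (v : L -> M) p :
  span u p = span (split_val u v) (span_map inl p).
Proof. by case: p => [|[]]. Qed.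

Let snd_ (K L : finType) (u : K -> M) (v : L -> M) p :
  span v p = span (split_val u v) (span_map inr p).
Proof. by case: p => [|[]]. Qed.

Section Relation.
Variable R : M -> M -> Prop.
Hypotheses (R_sym : forall x y, R x y -> R y x).
Hypotheses (R_trans : forall x y z, R x y -> R y z -> R x z).
Hypotheses (R_same : forall (K : finType) (u v : K -> M), same_diagram u v ->
  forall p q, R (span u p) (span u q) <-> R (span v p) (span v q)).

(** The relation between a term over [b] and [d_k] and a term over [d_k] belongs to the diagram,
    hence is the same for k = 1, 2, 3. So [span d1 p] and [span d2 p] are related, and [d12] carries
    this over to [span e2 p]. *)
Lemma constant_span x p : constant_up_to R x ->
  R x (span d2 p) \/ R x (span d3 p) ->
  [/\ R x (span d2 p), R x (span d3 p) & R x (span e2 p)].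
Proof.
move=> [r [x1 x2 x3]] xp.
have : [/\ R x (span d1 p), R x (span d2 p) & R x (span d3 p)].
  have b12' : R (span (split_val b d1) r) (span d1 p) <->
              R (span (split_val b d2) r) (span d2 p).
    by rewrite (snd_ b d1 p) (snd_ b d2 p); apply: R_same.
  have b23' : R (span (split_val b d2) r) (span d2 p) <->
              R (span (split_val b d3) r) (span d3 p).
    by rewrite (snd_ b d2 p) (snd_ b d3 p); apply: R_same.
  case: xp => xp.
    have y2 : R (span (split_val b d2) r) (span d2 p)
      by apply: R_trans xp; apply: R_sym.
    by split=> //;
      [apply: R_trans x1 _; apply/b12' | apply: R_trans x3 _; apply/b23'].
  have y2 : R (span (split_val b d2) r) (span d2 p).
    by apply/b23'; apply: R_trans xp; apply: R_sym.
  by split=> //; [apply: R_trans x1 _; apply/b12' | apply: R_trans x2 _].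
case=> y1 y2 y3; split=> //; apply: (R_trans y1).
have /R_same/(_ (span_map inl p) (span_map inr p)) := d12.
by rewrite -!fst_ -!snd_ => H; apply/H; apply: R_trans y2; apply: R_sym.
Qed.

(** The tuple [e0] is a pivot: by [e03], [e02] and [e01], [span e0 p] is related to [span d_k q] for
    each k, so these three are related to one another. Hence [span e2 p] is related to [span d1 q],
    and by [d12] so is [span d2 p]. *)
Lemma constant_overlap p q : R (span e2 p) (span d3 q) ->
  R (span d2 p) (span e2 p) /\ constant_up_to R (span d2 p).
Proof.
move=> e2d3.
have /R_same/(_ (span_map inl p) (span_map inr q)) H1 := e01.
have /R_same/(_ (span_map inl p) (span_map inr q)) H2 := e02.
have /R_same/(_ (span_map inl p) (span_map inr q)) H3 := e03.
have /R_same/(_ (span_map inr p) (span_map inl q)) H4 := d12.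
rewrite -!fst_ -!snd_ in H1 H2 H3 H4.
have x3 : R (span e0 p) (span d3 q) by apply/H3.
have x2 : R (span e0 p) (span d2 q) by apply/H2.
have x1 : R (span e0 p) (span d1 q) by apply/H1.
have tr x y z : R x y -> R x z -> R y z by move=> /R_sym; apply: R_trans.
have d31 := tr _ _ _ x3 x1; have d12' := tr _ _ _ x1 x2.
have e2d1 := R_trans e2d3 d31; have d2d1 : R (span d2 p) (span d1 q) by apply/H4.
split; first by apply: R_trans d2d1 _; apply: R_sym.
exists (span_map inr q); rewrite -!snd_; split=> //.
  exact: R_trans d2d1 d12'.
by apply: R_trans d2d1 _; apply: R_sym.
Qed.

End Relation.

(** Applied to equality and then to [EM], [constant_span] supplies the triangle conditions starting
    from [D] and [D'], and [constant_overlap] those starting from [B1] and [B2]. *)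
Lemma triangle_amalgamation :
  exists (P : structure sel_lang) (g : corner -> M -> P),
  [/\ sel_axioms P, forall k, sel_embedding (g k),
      forall j, g Left (b j) = g Right (b j),
      forall i, g Left (d2 i) = g Base (e2 i)
    & forall i, g Right (d3 i) = g Base (d3 i)].
Proof.
have de : same_diagram d2 e2 by have := same_diagram_comp inr d12.
have /choice[s sP] x : exists y, forall p, x = span d2 p -> y = span e2 p.
  have [[p xp]|no] := pselect (exists p, x = span d2 p).
    by exists (span e2 p) => q xq; apply/(same_eq de); rewrite -xp.
  by exists x => p xp; case: no; exists p.
have sE p : s (span d2 p) = span e2 p by apply: sP.
pose B1 x := exists p, x = span d2 p.
pose B2 x := exists p, x = span d3 p.
pose D := constant_up_to eq; pose D' x := OM x /\ constant_up_to (@EM M) x.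
have E_trans x y z : @EM M x y -> EM y z -> EM x z.
  by move=> xy yz; apply: (sel_E_transM HM (y := y)).
have D1E := constant_span (@esym _) (@etrans _) (fun K u v => @same_eq M K u v).
have D2E :=
  constant_overlap (@esym _) (@etrans _) (fun K u v => @same_eq M K u v).
have C1E := constant_span (sel_E_symM HM) E_trans (fun K u v => @same_E M K u v).
have C2E :=
  constant_overlap (sel_E_symM HM) E_trans (fun K u v => @same_E M K u v).
have A : amalgamable B1 B2 D D' s.
  split.
  - by move=> _ _ [p ->] [q ->]; have [r ->] := span_eval d2 HM p q; exists r.
  - by move=> _ _ [p ->] [q ->]; have [r ->] := span_eval d3 HM p q; exists r.
  - move=> x y Dx [Oy [q [y1 y2 y3]]].
    have [Fx|nFx] := pselect (FM x); last by rewrite (sel_junkM HM) // => -[].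
    case: Dx => r [x1 x2 x3].
    have evE z : EM y z -> evalM x y = evalM x z.
      move=> yz; apply: (sel_eval_constM HM) => //.
      by have [] := sel_E_domM HM yz.
    (* The term [t] computing the value over [d1] computes it over [d2] and [d3] as well, because
       eval is part of the diagram. *)
    have [t t1] := span_eval (split_val b d1) HM r q.
    have t2 := proj1 (same_eval b12 r q t) t1.
    have t3 := proj1 (same_eval b23 r q t) t2.
    exists t; split.
    + by rewrite -t1 -x1; apply: evE.
    + by rewrite -t2 -x2; apply: evE.
    + by rewrite -t3 -x3; apply: evE.
  - move=> x [r [x1 x2 x3]] Ox; split=> //.
    by exists r; rewrite -x1 -x2 -x3; split; apply: (sel_E_reflM HM).
  - by move=> _ [p ->]; rewrite sE; apply: iff_sym; apply: (same_F de).
  - by move=> _ [p ->]; rewrite sE; apply: iff_sym; apply: (same_O0 de).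
  - by move=> _ [p ->]; rewrite sE; apply: iff_sym; apply: (same_O1 de).
  - by move=> _ _ [p ->] [q ->]; rewrite !sE; apply: iff_sym; apply: (same_E de).
  - by move=> _ _ [p ->] [q ->]; rewrite !sE; apply: iff_sym; apply: (same_R0 de).
  - move=> _ _ [p ->] [q ->]; have [r r2] := span_eval d2 HM p q.
    by rewrite r2 !sE; apply/esym/(same_eval de).
  - split.
    + by move=> _ _ [p ->] [q ->]; rewrite !sE => /(same_eq de).
    + move=> x Dx [p xp]; have [_ x3 xe] := D1E _ p Dx (or_introl xp).
      by split; [rewrite {1}xp sE | exists p].
    + move=> x Dx [p xp]; have [x2 _ xe] := D1E _ p Dx (or_intror xp).
      by split; [exists p | rewrite {1}x2 sE].
    + move=> _ [p ->] [q]; rewrite sE => /D2E [-> Dx].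
      by [].
  - move=> x _ [Ox Cx] [p ->] xp; have [x2 x3 xe] := C1E _ p Cx (or_introl xp).
    rewrite sE; split; last exists (span d3 p); first last.
    + by apply: E_trans x3; apply: (sel_E_symM HM).
    + by exists p.
    + by apply: E_trans xe; apply: (sel_E_symM HM).
  - move=> x _ [Ox Cx] [p ->] xp; have [x2 x3 xe] := C1E _ p Cx (or_intror xp).
    exists (span d2 p); rewrite sE; split; first by exists p.
    + by apply: E_trans x2; apply: (sel_E_symM HM).
    + by apply: E_trans xe; apply: (sel_E_symM HM).
  - move=> _ _ [p ->] [q ->]; rewrite sE => /C2E [de2 Cx]; split=> //; split=> //.
    by have [] := sel_E_domM HM de2.
have [P [g [HP gemb glink]]] := amalgamation HM A.
exists P, g; split=> // [j|i|i]; apply: glink => /=.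
(* The same index names [b j] over each of [d1], [d2], [d3], so [b j] lies in [D]. *)
- by split=> //; exists (inl (inl j)).
- by split; [exists (inl i) | apply: (sE (inl i))].
- by split=> //; exists (inl i).
Qed.

End Triangle.

(** * Climbing the binary tree *)

Section Tree.
Variables (C : finType) (c : seq bool -> seq bool -> C).

(** Among the nodes [w 0^i 1] above the latest node [w] of [h] (the root if [h] is empty), two have
    the same colours against all of [h]. The one with fewer zeros leaves, by a 1, the path to the
    other. *)
Lemma tree_step (h : seq (seq bool)) : exists st : seq bool * seq bool,
  [/\ exists v u, st.1 = rcons v true /\ st.2 = v ++ false :: u,
      prefix (head [::] h) st.2, size (head [::] h) < size st.2
    & forall p, p \in h -> c p st.1 = c p st.2].
Proof.
pose w := head [::] h; pose nu i := rcons (w ++ nseq i false) true.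
have [i [j [ij /(congr1 val)/= cij]]] :=
  pigeonhole (fun i => [tuple of [seq c p (nu i) | p <- in_tuple h]]).
exists (nu i, nu j); split=> /=.
- exists (w ++ nseq i false), (nseq (j - i.+1) false ++ [:: true]).
  have jE : nseq j false = nseq i false ++ false :: nseq (j - i.+1) false.
    by rewrite -[false :: _]/(nseq _.+1 false) subnSK // -nseqD subnKC // ltnW.
  by split=> //; rewrite /nu jE -cats1 -!catA.
- by rewrite /nu rcons_cat prefix_prefix.
- by rewrite /nu size_rcons size_cat ltnS leq_addr.
- by move=> p /nthP-/(_ [::])[k kh <-];
    have := congr1 (nth (c [::] [::]) ^~ k) cij; rewrite !(nth_map [::]).
Qed.

Lemma tree_sequence : exists eta nu : nat -> seq bool,
  [/\ forall n, exists v u, nu n = rcons v true /\ eta n = v ++ false :: u,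
      forall n, n < size (eta n),
      forall i j, i <= j -> prefix (eta i) (eta j)
    & forall i j, i < j -> c (eta i) (nu j) = c (eta i) (eta j)].
Proof.
have /choice[st stP] := tree_step.
(* [hist n] lists the first [n] branch nodes, latest first, so its head is the node to extend. *)
pose hist n := iter n (fun h => (st h).2 :: h) [::].
exists (fun n => (st (hist n)).2), (fun n => (st (hist n)).1).
split=> [n|n|i j|i j].
- by have [] := stP (hist n).
- elim: n => [|n IH]; first by have [] := stP [::].
  by have [_ _ H _] := stP (hist n.+1); apply: leq_ltn_trans H.
- elim: j => [|j IH]; first by rewrite leqn0 => /eqP->; apply: prefix_refl.
  rewrite leq_eqVlt => /predU1P[->|/IH H]; first exact: prefix_refl.
  by have [_ H' _ _] := stP (hist j.+1); apply: prefix_trans H H'.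
move=> ij; have [_ _ _] := stP (hist j); apply.
elim: j ij => // j IH; rewrite ltnS leq_eqVlt inE => /predU1P[->|/IH->].
  by rewrite eqxx.
by rewrite orbT.
Qed.

End Tree.

Lemma meet_cat (v s t : seq bool) : meet (v ++ s) (v ++ t) = v ++ meet s t.
Proof. by elim: v => //= x v ->; rewrite eqxx. Qed.

Lemma branch_through (eta : nat -> seq bool) :
  (forall n, n < size (eta n)) ->
  (forall i j, i <= j -> prefix (eta i) (eta j)) ->
  exists br : nat -> bool, forall n, mkseq br (size (eta n)) = eta n.
Proof.
move=> sz pre; exists (fun k => nth false (eta k) k) => n.
apply: (@eq_from_nth _ false); rewrite size_mkseq // => k kn.
rewrite nth_mkseq //; have [/pre|/ltnW/pre] := leqP k n.
  by move=> /prefixP[u ->]; rewrite nth_cat sz.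
by move=> /prefixP[u ->]; rewrite nth_cat kn.
Qed.

(** * Contradiction from an SOP1 tree *)

Theorem corollary4p14 (Tstar : theory sel_lang)
  (hTstar : model_completion sel_theory Tstar) : NSOP1 Tstar.
Proof.
(* Model completeness: [mc_complete] is applied over [N] to its identity map and [f]. *)
have emb_elem (N Q : structure sel_lang) (f : N -> Q) :
    models N Tstar -> models Q Tstar -> embedding f -> elementary f.
  move=> HN HQ fe V v phi.
  have ide : embedding (@id N) by split.
  exact: (mc_complete hTstar (mc_extends hTstar HN) HN HQ ide fe v phi).
have elem_models (N Q : structure sel_lang) (f : N -> Q) :
    elementary f -> models N Tstar -> models Q Tstar.
  move=> fe HN t /HN /(fe _ (of_void N)).
  by have -> : f \o of_void N = of_void Q by apply/funext => -[].
case=> n [m [phi [M [a [HM cons incons]]]]].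
have [eta [nu [fork sz pre cE]]] := tree_sequence
  (fun p q => diagram (split_val (a p) (a q))).
have [br brE] := branch_through sz pre.
have [N [e [ee [b bE]]]] := cons br.
have HN := elem_models _ _ _ ee HM.
have semb_e := elementary_sel_embedding ee.
pose d k := e \o a (eta k); pose d' k := e \o a (nu k).
have [i0 [i1 [i2 [i3 [[i01 [i12 i23]] b12 b23 [e01 e02] e03]]]]] := ramsey_pattern
  (fun k => diagram (split_val b (d k)))
  (fun k l => diagram (split_val (d' k) (d l))).
have split_comp (u v : 'I_m -> M) :
    split_val (e \o u) (e \o v) = e \o split_val u v.
  by apply/funext => -[].
(* The tree colouring uses diagrams in [M], which [e] preserves; [cE] applies because [i1 < i2]. *)
have d12 : diagram (split_val (d i1) (d i2)) = diagram (split_val (d i1) (d' i2)).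
  by rewrite !split_comp !diagram_emb // cE.
have HselN : sel_axioms N by apply/models_sel_theory/(mc_extends hTstar).
have [P [g [HP gemb gb g2 g3]]] := triangle_amalgamation HselN
  (diagramP b12) (diagramP b23) (diagramP d12) (diagramP e01) (diagramP e02)
  (diagramP e03).
have HPT : models P sel_theory by apply/models_sel_theory.
have [Q [f [HQ femb]]] := mc_embeds hTstar HPT.
have gf k : elementary (f \o g k).
  apply: emb_elem => //; have [gi gfun grel] := sel_embeddingP HselN HP (gemb k).
  have [fi ffun_ frel] := femb; split; first exact: inj_comp.
  - by move=> h x /=; rewrite gfun ffun_.
  - by move=> r x; rewrite grel frel.
(* The node [eta i3] extends [eta i2], hence passes through [v] followed by 0, while [nu i2] is [v]
   followed by 1. *)
have [v [u [nuE etaE2]]] := fork i2.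
have [u' etaE] : exists u', eta i3 = v ++ false :: u'.
  have /prefixP[t ->] := pre _ _ (ltnW i23).
  by exists (u ++ t); rewrite etaE2 -catA.
have meetE : meet (eta i3) (nu i2) = v.
  by rewrite etaE nuE -cats1 meet_cat /= cats0.
apply: (incons (eta i3) (nu i2)).
- rewrite etaE nuE -cats1 /incomparable.
  by rewrite !prefix_catr // eqxx.
- by rewrite meetE etaE -cats1 prefix_catr // eqxx /= prefix0s.
- by rewrite meetE nuE.
(* [M] enters [Q] through Base, where the parameters at [nu i2] are glued to [d i2] in Left and
   those at [eta i3] to [d i3] in Right; [phi] holds of [b] in both of these copies. *)
exists Q, (f \o g Base \o e); split.
  by move=> V w psi; rewrite (ee _ w) (gf Base).
exists (f \o g Right \o b) => -[].
- have /(gf Left) := bE (size (eta i2)); rewrite brE.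
  congr (sat _ phi); apply/funext => -[j|i] /=; first by rewrite gb.
  by have /= -> := g2 i.
- have /(gf Right) := bE (size (eta i3)); rewrite brE.
  congr (sat _ phi); apply/funext => -[j|i] //=.
  by have /= -> := g3 i.
Qed.
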